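(* Let $n\ge1$ be an integer. For all $f,g\in C[0,1]$ and all $x\in[0,1]$, $$|T(f,g;x)|\le\frac12\left(1-\sum_{k=0}^nu_{n,k}^2(x)\right)\cdot osc_{S_{\Delta_n}}(f)\cdot osc_{S_{\Delta_n}}(g)\le\frac12\left(1-\frac12\right)\cdot osc_{S_{\Delta_n}}(f)\cdot osc_{S_{\Delta_n}}(g)\le\frac14\cdot osc_{S_{\Delta_n}}(f)\cdot osc_{S_{\Delta_n}}(g).$$
   Context: $S_{\Delta_n}:C[0,1]\to C[0,1]$ is the operator of piecewise linear interpolation at $0,\frac1n,\dots,\frac{n-1}n,1$: $S_{\Delta_n}f(x)=\sum_{k=0}^nf\left(\frac kn\right)u_{n,k}(x)$, where $u_{n,k}\in C[0,1]$ is linear on each interval $[\frac{l-1}n,\frac ln]$, $l=1,\dots,n$, and $u_{n,k}\left(\frac ln\right)=\delta_{kl}$ for $k,l=0,\dots,n$. $T(f,g;x):=S_{\Delta_n}(fg)(x)-S_{\Delta_n}f(x)\cdot S_{\Delta_n}g(x)$. The oscillation is $osc_{S_{\Delta_n}}(f):=\max\{|f(k/n)-f(l/n)|:0\le k<l\le n\}$, and similarly for $g$. *)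

(* Defs.v *)
From HB Require Import structures.
From mathcomp Require Import all_boot all_order all_algebra.
From mathcomp Require Import all_classical all_reals all_analysis.
From mathcomp Require Import ring lra.
Set Implicit Arguments.
Unset Strict Implicit.
Unset Printing Implicit Defensive.
Import Order.TTheory GRing.Theory Num.Theory.
Import numFieldNormedType.Exports.
Local Open Scope classical_set_scope.
Local Open Scope ring_scope.

(* C[0,1] is rendered by total functions R -> R that are continuous on `[0, 1]
   for the subspace topology; their values outside `[0, 1] are irrelevant. *)
Definition C01 (R : realType) (f : R -> R) : Prop :=
  {within `[0, 1], continuous f}.

Definition node (R : realType) (n k : nat) : R := k%:R / n%:R.

(* "Linear" is meant in the sense of interpolation, that is, affine. *)
Definition linear_on (R : realType) (f : R -> R) (a b : R) : Prop :=
  exists c d : R, forall x : R, a <= x <= b -> f x = c * x + d.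

Definition is_hat_basis (R : realType) (n : nat) (u : 'I_n.+1 -> R -> R) : Prop :=
  forall k : 'I_n.+1,
    [/\ C01 (u k),
        forall l : nat, (1 <= l <= n)%N ->
          linear_on (u k) (node R n l.-1) (node R n l)
      & forall l : 'I_n.+1, u k (node R n l) = (k == l)%:R].

Definition interp (R : realType) (n : nat) (u : 'I_n.+1 -> R -> R)
    (f : R -> R) (x : R) : R :=
  \sum_(k < n.+1) f (node R n k) * u k x.

Definition chebT (R : realType) (n : nat) (u : 'I_n.+1 -> R -> R)
    (f g : R -> R) (x : R) : R :=
  interp u (fun y => f y * g y) x - interp u f x * interp u g x.

(* The values are nonnegative and, for 1 <= n, the index set is nonempty, so
   the default value 0 of the iterated maximum plays no role. *)
Definition osc (R : realType) (n : nat) (f : R -> R) : R :=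
  \big[Num.max/0]_(p : 'I_n.+1 * 'I_n.+1 | (p.1 < p.2)%N)
    `|f (node R n p.1) - f (node R n p.2)|.

(* The conditions in [is_hat_basis] determine the u_{n,k} on `[0, 1]:
   existence and uniqueness. *)
Lemma is_hat_basis_exists (R : realType) (n : nat) (hn : (1 <= n)%N) :
  exists u : 'I_n.+1 -> R -> R, is_hat_basis u.
Proof.
have n0 : (0 : R) < n%:R by rewrite ltr0n.
have nn0 : (n%:R : R) != 0 by rewrite gt_eqF.
exists (fun k x => Num.max 0 (1 - `|n%:R * x - k%:R|)) => k; split.
- apply: continuous_subspaceT => x.
  apply: (@continuous_max _ _ (cst 0) (fun x : R => 1 - `|n%:R * x - k%:R|));
    first exact: cvg_cst.
  apply: cvgB; first exact: cvg_cst.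
  apply: cvg_norm; apply: cvgB; last exact: cvg_cst.
  by apply: cvgM; [exact: cvg_cst | exact: cvg_id].
- move=> [//|l] /andP[_ ln]; rewrite /node /=.
  have bnd (x : R) : l%:R / n%:R <= x <= l.+1%:R / n%:R ->
      l%:R <= n%:R * x <= l%:R + 1.
    by rewrite ler_pdivrMr // ler_pdivlMr // -natr1 mulrC.
  have [kl|] := ltnP k l.
    exists 0, 0 => x /bnd /andP[h1 h2]; rewrite mul0r addr0.
    have : k%:R + 1 <= (l%:R : R) by rewrite natr1 ler_nat.
    move=> h; apply/max_idPl; rewrite ger0_norm; lra.
  rewrite leq_eqVlt => /orP[/eqP kl|].
    exists (- n%:R), (1 + k%:R) => x /bnd /andP[h1 h2]; rewrite kl in h1 h2 *.
    rewrite ger0_norm; last by lra.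
    have -> : 1 - (n%:R * x - k%:R) = - n%:R * x + (1 + k%:R) :> R by ring.
    by apply/max_idPr; lra.
  rewrite leq_eqVlt => /orP[/eqP kl|kl].
    exists n%:R, (1 - k%:R) => x /bnd /andP[h1 h2].
    have e : k%:R = l%:R + 1 :> R by rewrite -kl -natr1.
    rewrite ler0_norm; last by lra.
    have -> : 1 - - (n%:R * x - k%:R) = n%:R * x + (1 - k%:R) :> R by ring.
    by apply/max_idPr; lra.
  exists 0, 0 => x /bnd /andP[h1 h2]; rewrite mul0r addr0.
  have : l%:R + 2 <= (k%:R : R) by rewrite -natrD addn2 ler_nat.
  move=> h; apply/max_idPl; rewrite ler0_norm; lra.
- move=> l; rewrite /node mulrCA divff // mulr1.
  have [->|kl] := eqVneq k l.
    by rewrite subrr normr0 subr0; apply/max_idPr; lra.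
  apply/max_idPl; rewrite subr_le0.
  have /orP[h|h] : ((k < l) || (l < k))%N by rewrite -neq_ltn.
    have : k%:R + 1 <= (l%:R : R) by rewrite natr1 ler_nat.
    by move=> h'; rewrite ger0_norm; lra.
  have : l%:R + 1 <= (k%:R : R) by rewrite natr1 ler_nat.
  by move=> h'; rewrite ler0_norm; lra.
Qed.

Lemma is_hat_basis_unique (R : realType) (n : nat) (hn : (1 <= n)%N)
    (u v : 'I_n.+1 -> R -> R) :
  is_hat_basis u -> is_hat_basis v ->
  forall (k : 'I_n.+1) (x : R), 0 <= x <= 1 -> u k x = v k x.
Proof.
have n0 : (0 : R) < n%:R by rewrite ltr0n.
move=> hu hv k x /andP[x0 x1].
have [l ln lx] : exists2 l : nat, (l < n)%N &
    node R n l <= x <= node R n l.+1.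
  have : exists l, (l < n)%N && (x <= node R n l.+1).
    exists n.-1; rewrite prednK // leqnn /= /node.
    by rewrite divff // gt_eqF.
  move=> /ex_minnP [l /andP[ln xl] lmin]; exists l => //; rewrite xl andbT.
  case: l ln xl lmin => [|l] ln xl lmin; first by rewrite /node mul0r.
  rewrite leNgt; apply/negP => h.
  by have := lmin l; rewrite (ltW h) (ltnW ln) ltnn => /(_ isT).
have [_ ua un] := hu k; have [_ va vn] := hv k.
have [a [b ab]] := ua l.+1 ln; have [c [d cd]] := va l.+1 ln.
have lt : node R n l < node R n l.+1.
  by rewrite /node ltr_pM2r ?invr_gt0 // ltr_nat.
have ln1 : (l < n.+1)%N by exact: ltnW.
have := un (Ordinal ln1); have := vn (Ordinal ln1).
have := un (Ordinal (ln : (l.+1 < n.+1)%N)).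
have := vn (Ordinal (ln : (l.+1 < n.+1)%N)).
rewrite /= in ab cd *.
rewrite !ab ?cd ?lexx ?(ltW lt) ?lx // => <- e1 <- e2.
have : (a - c) * (node R n l.+1 - node R n l) = 0 by lra.
move=> /eqP; rewrite mulf_eq0 !subr_eq0 (gt_eqF lt) orbF => /eqP ac.
by move: e1; rewrite ac => /addrI ->.
Qed.

(* Main.v *)
(** A point x of [0, 1] lies in some [l/n, (l+1)/n], where every u_{n,k} is
    affine; with t = n x - l, only u_{n,l}(x) = 1 - t and u_{n,l+1}(x) = t are
    possibly nonzero. Hence T(f,g;x) is t (1 - t) times the product of the increments of
    f and g between the two nodes, while 1 - sum_k u_{n,k}(x)^2 = 2 t (1 - t),
    and t (1 - t) <= 1/4. *)

Require Import Defs.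
From HB Require Import structures.
From mathcomp Require Import all_boot all_order all_algebra.
From mathcomp Require Import all_classical all_reals all_analysis.
From mathcomp Require Import ring lra.
Set Implicit Arguments.
Unset Strict Implicit.
Unset Printing Implicit Defensive.
Import Order.TTheory GRing.Theory Num.Theory.
Import numFieldNormedType.Exports.
Local Open Scope classical_set_scope.
Local Open Scope ring_scope.

(** Take the least [l] with [x <= node R n l.+1]: minimality forces [node R n l <= x], and for
    [l = 0] this is [0 <= x]. *)
Lemma node_bracket (R : realType) (n : nat) (x : R) :
  (1 <= n)%N -> 0 <= x <= 1 ->
  exists2 l : nat, (l < n)%N & node R n l <= x <= node R n l.+1.
Proof.
move=> n_gt0 /andP[x_ge0 x_le1].
have /ex_minnP[l /andP[ln xl] lmin] :
    exists l, (l < n)%N && (x <= node R n l.+1).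
  exists n.-1; rewrite prednK // leqnn /= /node divff // pnatr_eq0.
  by rewrite -lt0n.
exists l => //; rewrite xl andbT.
case: l ln xl lmin => [|l] ln xl lmin; first by rewrite /node mul0r.
rewrite leNgt; apply/negP => /ltW x_le.
by have := lmin l; rewrite x_le (ltnW ln) ltnn => /(_ isT).
Qed.

Lemma linear_on_convex (R : realType) (f : R -> R) (a b t : R) :
  linear_on f a b -> a <= b -> 0 <= t <= 1 ->
  f ((1 - t) * a + t * b) = (1 - t) * f a + t * f b.
Proof.
move=> [c [d fE]] ab /andP[t_ge0 t_le1].
rewrite !fE ?lexx ?ab //; first by ring.
(* These are the distances of the convex combination from [a] and from [b], so it stays in the
   interval where [f] is affine. *)
have ? : 0 <= t * (b - a) by rewrite mulr_ge0 // subr_ge0.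
have ? : 0 <= (1 - t) * (b - a) by rewrite mulr_ge0 // subr_ge0.
by apply/andP; split; lra.
Qed.

(** One pair [i], [j] and one weight [t] serve all [k] at once, so every sum over the basis
    collapses to two terms. *)
Lemma hat_basis_two_nodes (R : realType) (n : nat) (u : 'I_n.+1 -> R -> R)
    (x : R) :
  (1 <= n)%N -> is_hat_basis u -> 0 <= x <= 1 ->
  exists (i j : 'I_n.+1) (t : R), [/\ (i < j)%N, 0 <= t <= 1 &
    forall k, u k x = (1 - t) * (k == i)%:R + t * (k == j)%:R].
Proof.
move=> n_gt0 hu x01; have [l ln /andP[lx xl]] := node_bracket n_gt0 x01.
have n0 : (0 : R) < n%:R by rewrite ltr0n.
pose i : 'I_n.+1 := Ordinal (ltnW ln : (l < n.+1)%N).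
pose j : 'I_n.+1 := Ordinal (ln : (l.+1 < n.+1)%N).
move: lx xl; rewrite /node ler_pdivrMr // ler_pdivlMr // -natr1 => lx xl.
have t01 : 0 <= x * n%:R - l%:R <= 1 by apply/andP; split; lra.
exists i, j, (x * n%:R - l%:R); split => // k.
have [_ /(_ l.+1 ln) /= ulin unode] := hu k.
(* The Kronecker deltas are read backwards as values of [u k] at the two nodes, whose convex
   combination with weight [t] is [x]. *)
rewrite -(unode i) -(unode j) -linear_on_convex //.
  by congr (u k _); rewrite /node /= -natr1; field; rewrite gt_eqF.
by rewrite /node ler_pM2r ?invr_gt0 // ler_nat.
Qed.

(** [F] is arbitrary so that nodal values give [interp], while [F = v] gives the sum of squares. *)
Lemma sum_two_nodes (R : pzRingType) (m : nat) (F v : 'I_m -> R)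
    (i j : 'I_m) (a b : R) :
  (forall k, v k = a * (k == i)%:R + b * (k == j)%:R) ->
  \sum_(k < m) F k * v k = F i * a + F j * b.
Proof.
have sum1 (c : R) p : \sum_(k < m) F k * (c * (k == p)%:R) = F p * c.
  rewrite (bigD1 p) //= eqxx mulr1 big1 ?addr0 // => k /negPf ->.
  by rewrite !mulr0.
move=> vE; rewrite -!sum1 -big_split.
by apply: eq_bigr => k _; rewrite vE mulrDr.
Qed.

Lemma le_osc (R : realType) (n : nat) (f : R -> R) (i j : 'I_n.+1) :
  (i < j)%N -> `|f (node R n i) - f (node R n j)| <= osc n f.
Proof.
move=> ij; rewrite /osc.
exact: (le_bigmax_cond _ (fun p : 'I_n.+1 * 'I_n.+1 =>
  `|f (node R n p.1) - f (node R n p.2)|) (j := (i, j))).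
Qed.

Theorem theorem5p3 (R : realType) (n : nat) (hn : (1 <= n)%N)
  (u : 'I_n.+1 -> R -> R) (hu : is_hat_basis u)
  (f g : R -> R) (hf : C01 f) (hg : C01 g) (x : R) (hx : 0 <= x <= 1) :
  [/\ `|chebT u f g x|
        <= 1 / 2 * (1 - \sum_(k < n.+1) u k x ^+ 2) * osc n f * osc n g,
      1 / 2 * (1 - \sum_(k < n.+1) u k x ^+ 2) * osc n f * osc n g
        <= 1 / 2 * (1 - 1 / 2) * osc n f * osc n g
    & 1 / 2 * (1 - 1 / 2) * osc n f * osc n g
        <= 1 / 4 * osc n f * osc n g].
Proof.
have [i [j [t [ij /andP[t_ge0 t_le1] uE]]]] := hat_basis_two_nodes hn hu hx.
have sumE F := sum_two_nodes F uE.
have neq_ij : (i == j) = false by rewrite -val_eqE /= ltn_eqF.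
have -> : \sum_(k < n.+1) u k x ^+ 2 = (1 - t) ^+ 2 + t ^+ 2.
  rewrite (sumE (u^~ x)) !uE !eqxx neq_ij eq_sym neq_ij.
  by rewrite !mulr0 !mulr1 addr0 add0r.
have osc_f := le_osc f ij; have osc_g := le_osc g ij.
have f_ge0 := le_trans (normr_ge0 _) osc_f.
have g_ge0 := le_trans (normr_ge0 _) osc_g.
have t1t_ge0 : 0 <= t * (1 - t) by rewrite mulr_ge0 // subr_ge0.
split.
- rewrite /chebT /interp !sumE.
  set fi := f (node R n i); set fj := f (node R n j).
  set gi := g (node R n i); set gj := g (node R n j).
  (* This is the covariance of a two-point distribution with weights [1 - t] and [t]. *)
  have -> : fi * gi * (1 - t) + fj * gj * t
      - (fi * (1 - t) + fj * t) * (gi * (1 - t) + gj * t)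
      = t * (1 - t) * ((fi - fj) * (gi - gj)) by ring.
  have -> : 1 / 2 * (1 - ((1 - t) ^+ 2 + t ^+ 2)) = t * (1 - t) by field.
  by rewrite normrM ger0_norm // normrM -(mulrA (t * (1 - t))) ler_wpM2l ?ler_pM.
(* Without the oscillation factors the claim is [t * (1 - t) <= 1 / 4], that is,
   [0 <= (t - 1 / 2) ^+ 2]. *)
- do 2![apply: ler_wpM2r => //]; have := sqr_ge0 (t - 1 / 2); lra.
- by have -> : 1 / 2 * (1 - 1 / 2) = 1 / 4 :> R by field.
Qed.
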